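(* Let $A$ be a countable index set. For each $\alpha \in A$ let $G_\alpha$ be a second-countable profinite group and $T_\alpha: G_\alpha \to G_\alpha$ a quotient-preserving map. Let $G = \prod_{\alpha \in A} G_\alpha$ and $T = \prod_{\alpha \in A} T_\alpha: G \to G$. Then $G$ is second-countable and: (1) $T$ is nonsingular if and only if $T_\alpha$ is nonsingular for each $\alpha \in A$. (2) Put $D_\alpha = \{ |G_\alpha/N_\alpha| : N_\alpha \in \mathcal{F}(T_\alpha) \}$. Then $T$ is ergodic if and only if $T_\alpha$ is ergodic for each $\alpha \in A$ and, for all distinct $\alpha,\beta \in A$ and all $n \in D_\alpha$, $m \in D_\beta$, we have $\gcd(n,m)=1$.
   Context: A profinite group is a topological group isomorphic to an inverse limit of finite discrete groups. $N \lhd_O G$ means that $N$ is an open normal subgroup of $G$; $\pi_N: G \to G/N$ is the quotient map. A map $T: G\to G$ (not assumed to be a homomorphism) factors through $\pi_N$ if there is a map $T_N: G/N \to G/N$ with $\pi_N \circ T = T_N \circ \pi_N$. The finite factor set of $T$ is $\mathcal{F}(T) = \{ N \lhd_O G : T \text{ factors through } \pi_N\}$. $T$ is a quotient-preserving map if the cosets of the elements of $\mathcal{F}(T)$ form a base for the topology of $G$. The product $G$ carries the product topology, and $T$ acts coordinatewise by the $T_\alpha$. Nonsingularity and ergodicity are with respect to normalized Haar measure on the Borel $\sigma$-algebra of the relevant group. For a probability space $(X,\mathcal{B},\mu)$ and a measurable $S: X\to X$: $S$ is nonsingular if for all $A \in \mathcal{B}$, $\mu(S^{-1}A)=0$ if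 and only if $\mu(A)=0$. Convention: ergodicity is understood for nonsingular transformations, i.e. ''$S$ is ergodic'' means that $S$ is nonsingular and every $A\in\mathcal{B}$ with $S^{-1}A=A$ has $\mu(A)\in\{0,1\}$ (for quotient-preserving maps of second-countable profinite groups, nonsingular is equivalent to measure-preserving). *)

(* Defs.v *)
From HB Require Import structures.
From mathcomp Require Import all_boot all_order all_algebra.
From mathcomp Require Import all_classical all_reals all_analysis.

Set Implicit Arguments.
Unset Strict Implicit.
Unset Printing Implicit Defensive.

Local Open Scope classical_set_scope.
Local Open Scope card_scope.
Local Open Scope group_scope.

HB.mixin Record isTopologicalGroup G of Group G & Topological G := {
  mulg_continuous : continuous (fun xy : G * G => xy.1 * xy.2) ;
  invg_continuous : continuous (fun x : G => x^-1)
}.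

#[short(type="topologicalGroupType")]
HB.structure Definition TopologicalGroup :=
  {G of Group G & Topological G & isTopologicalGroup G}.

Section ProductGroup.
Context {I : Type} (G : I -> topologicalGroupType).

Local Notation P := (prod_topology G).

Definition prodg_one : P := fun=> 1.
Definition prodg_inv (x : P) : P := fun i => (x i)^-1.
Definition prodg_mul (x y : P) : P := fun i => x i * y i.

Fact prodg_mulA : associative prodg_mul.
Proof. by move=> x y z; apply: functional_extensionality_dep => i; apply: mulgA. Qed.
Fact prodg_mul1 : left_id prodg_one prodg_mul.
Proof. by move=> x; apply: functional_extensionality_dep => i; apply: mul1g. Qed.
Fact prodg_1mul : right_id prodg_one prodg_mul.
Proof. by move=> x; apply: functional_extensionality_dep => i; apply: mulg1. Qed.
Fact prodg_mulV : left_inverse prodg_one prodg_inv prodg_mul.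
Proof. by move=> x; apply: functional_extensionality_dep => i; apply: mulVg. Qed.
Fact prodg_Vmul : right_inverse prodg_one prodg_inv prodg_mul.
Proof. by move=> x; apply: functional_extensionality_dep => i; apply: mulgV. Qed.

HB.instance Definition _ :=
  isGroup.Build P prodg_mulA prodg_mul1 prodg_1mul prodg_mulV prodg_Vmul.

Fact prod_coord_continuous i : continuous (fun x : P => x i).
Proof.
move=> x; have /cvg_sup/(_ i) h : nbhs x --> x by apply: cvg_id.
apply: cvg_trans (@initial_continuous _ _ (fun f : (forall i, G i) => f i) x).
exact: cvg_app h.
Qed.

Fact continuous_into_prod (X : topologicalType) (f : X -> P) :
  (forall i, continuous (fun x => f x i)) -> continuous f.
Proof.
move=> fc x; apply/cvg_sup => i.
exact: (@continuous_comp_initial _ _ _ (fun g : (forall i, G i) => g i) f (fc i)).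
Qed.

Fact prodg_mul_continuous : continuous (fun xy : P * P => xy.1 * xy.2).
Proof.
apply: continuous_into_prod => i [x y].
apply: (@continuous2_cvg _ _ _ _ _ _ (fun xy : P * P => xy.1 i)
  (fun xy : P * P => xy.2 i) (fun a b : G i => a * b) (x i) (y i)).
- exact: (@mulg_continuous (G i) (x i, y i)).
- exact: (cvg_comp _ _ (@cvg_fst _ _ (nbhs x) (nbhs y) _)
    (@prod_coord_continuous i x)).
- exact: (cvg_comp _ _ (@cvg_snd _ _ (nbhs x) (nbhs y) _)
    (@prod_coord_continuous i y)).
Qed.

Fact prodg_inv_continuous : continuous (fun x : P => x^-1).
Proof.
apply: continuous_into_prod => i x.
apply: (continuous_comp (@prod_coord_continuous i x)).
exact: (@invg_continuous (G i)).
Qed.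

HB.instance Definition _ :=
  isTopologicalGroup.Build P prodg_mul_continuous prodg_inv_continuous.

End ProductGroup.

Record inverse_system := InverseSystem {
  is_disp : Order.disp_t ;
  is_index : porderType is_disp ;
  is_obj : is_index -> topologicalGroupType ;
  is_map : forall i j : is_index, (i <= j)%O -> is_obj j -> is_obj i ;
  is_index_inhabited : inhabited is_index ;
  is_index_directed :
    forall i j : is_index, exists k, (i <= k)%O /\ (j <= k)%O ;
  is_map_continuous :
    forall (i j : is_index) (ij : (i <= j)%O), continuous (is_map ij) ;
  is_mapM : forall (i j : is_index) (ij : (i <= j)%O),
    {morph is_map ij : x y / x * y} ;
  is_map_id : forall (i : is_index) (ii : (i <= i)%O), is_map ii =1 id ;
  is_map_comp : forall (i j k : is_index)
    (ij : (i <= j)%O) (jk : (j <= k)%O) (ik : (i <= k)%O),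
    is_map ij \o is_map jk =1 is_map ik
}.

Section InverseLimit.
Variable S : inverse_system.

Local Notation P := (prod_topology (@is_obj S)).

Definition invlim_set : set P :=
  [set x | forall (i j : is_index S) (ij : (i <= j)%O),
             is_map ij (x j) = x i].

Definition invlim : Type := set_type invlim_set.

HB.instance Definition _ := Topological.copy invlim (set_type invlim_set).
HB.instance Definition _ := SubChoice.copy invlim (set_type invlim_set).

Fact invlim_closed : group_closed [in invlim_set].
Proof.
have m1 i j (ij : (i <= j)%O) : is_map ij (1 : is_obj j) = 1.
  have /(congr1 (fun z => (is_map ij 1)^-1 * z)) := is_mapM ij 1 1.
  by rewrite mulg1 mulVg mulKg => <-.
have mV i j (ij : (i <= j)%O) (x : is_obj j) : is_map ij x^-1 = (is_map ij x)^-1.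
  by apply: (@mulIg _ (is_map ij x)); rewrite -is_mapM !mulVg m1.
split; first by rewrite inE => i j ij; apply: m1.
move=> x y; rewrite !inE => xS yS i j ij.
by rewrite [LHS]is_mapM mV xS yS.
Qed.

HB.instance Definition _ :=
  SubChoice_isSubGroup.Build P _ invlim invlim_closed.

Fact invlim_val_continuous : continuous (\val : invlim -> P).
Proof. exact: (@initial_continuous _ _ (@set_val _ invlim_set)). Qed.

Fact continuous_into_invlim (X : topologicalType) (f : X -> invlim) :
  continuous (\val \o f : X -> P) -> continuous f.
Proof. exact: (@continuous_comp_initial _ _ _ (@set_val _ invlim_set)). Qed.

Fact invlim_mul_continuous : continuous (fun xy : invlim * invlim => xy.1 * xy.2).
Proof.
apply: continuous_into_invlim => -[x y].
apply: (@continuous2_cvg _ _ _ _ _ _ (fun xy : invlim * invlim => \val xy.1 : P)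
  (fun xy : invlim * invlim => \val xy.2 : P) (fun a b : P => a * b)
  (\val x) (\val y)).
- exact: (@mulg_continuous P (\val x, \val y)).
- exact: (cvg_comp _ _ (@cvg_fst _ _ (nbhs x) (nbhs y) _)
    (@invlim_val_continuous x)).
- exact: (cvg_comp _ _ (@cvg_snd _ _ (nbhs x) (nbhs y) _)
    (@invlim_val_continuous y)).
Qed.

Fact invlim_inv_continuous : continuous (fun x : invlim => x^-1).
Proof.
apply: continuous_into_invlim => x.
apply: (continuous_comp (@invlim_val_continuous x)).
exact: (@invg_continuous P).
Qed.

HB.instance Definition _ :=
  isTopologicalGroup.Build invlim invlim_mul_continuous invlim_inv_continuous.

End InverseLimit.

Definition topologically_isomorphic (G H : topologicalGroupType) : Prop :=
  exists (f : G -> H) (g : H -> G),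
    [/\ {morph f : x y / x * y}, cancel f g, cancel g f,
        continuous f & continuous g].

Definition finite_discrete (G : topologicalGroupType) : Prop :=
  finite_set [set: G] /\ forall U : set G, open U.

Definition profinite (G : topologicalGroupType) : Prop :=
  exists S : inverse_system,
    (forall i : is_index S, finite_discrete (is_obj i)) /\
    topologically_isomorphic G (invlim S).

Section FiniteFactors.
Variable G : topologicalGroupType.
Implicit Types (N : set G) (T : G -> G).

Definition open_normal_subgroup N : Prop :=
  [/\ open N, group_closed [in N] & forall x y, N x -> N (x ^ y)].

Definition left_coset N (x : G) : set G := [set x * n | n in N].

Definition cosets N : set (set G) := range (left_coset N).

Definition quotient N : Type := set_type (cosets N).

Definition quotient_map N (x : G) : quotient N :=
  SigSub (mem_set (imageT (left_coset N) x)).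

Definition factors_through T N : Prop :=
  exists TN : quotient N -> quotient N, quotient_map N \o T = TN \o quotient_map N.

Definition finite_factor_set T : set (set G) :=
  [set N | open_normal_subgroup N /\ factors_through T N].

Definition quotient_preserving T : Prop :=
  basis (\bigcup_(N in finite_factor_set T) cosets N).

(* An open subgroup of a profinite group has finite index, so no member of the
   finite factor set is lost by asking the quotient to have [n] elements. *)
Definition factor_orders T : set nat :=
  [set n | exists2 N, finite_factor_set T N & [set: quotient N] #= `I_n].

End FiniteFactors.

(* Measurable spaces are pointed in the library; the point is the unit. *)
Definition borel (G : topologicalGroupType) : Type := G.

HB.instance Definition _ (G : topologicalGroupType) := Choice.on (borel G).
HB.instance Definition _ (G : topologicalGroupType) :=
  isPointed.Build (borel G) (1 : G).
HB.instance Definition _ (G : topologicalGroupType) :=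
  Measurable.copy (borel G)
    (g_sigma_algebraType (@open G : set (set (borel G)))).

(* Regularity is not required: every finite Borel measure on a second-countable
   profinite group is regular. *)
Definition normalized_haar (R : realType) (G : topologicalGroupType)
    (mu : probability (borel G) R) : Prop :=
  forall (g : G) (B : set (borel G)), measurable B ->
    mu [set g * x | x in (B : set G)] = mu B.

Section Dynamics.
Context d (X : measurableType d) (R : realType).
Implicit Types (mu : probability X R) (S : X -> X).

Definition nonsingular mu S : Prop :=
  measurable_fun setT S /\
  forall B, measurable B -> (mu (S @^-1` B) = 0%E <-> mu B = 0%E).

Definition ergodic mu S : Prop :=
  nonsingular mu S /\
  forall B, measurable B -> S @^-1` B = B -> mu B = 0%E \/ mu B = 1%E.

End Dynamics.

Definition prod_map (I : Type) (G : I -> topologicalGroupType)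
    (T : forall i, G i -> G i) (x : prod_topology G) : prod_topology G :=
  fun i => T i (x i).

(* Main.v *)
Require Import Defs.
From mathcomp Require Import all_boot all_order all_algebra.
From mathcomp Require Import all_classical all_reals all_analysis.

Set Implicit Arguments.
Unset Strict Implicit.
Unset Printing Implicit Defensive.

Local Open Scope classical_set_scope.
Local Open Scope card_scope.
Local Open Scope group_scope.

(** Everything is read off from the finite factors of the maps.

    Let T be a quotient-preserving map of a second-countable profinite group
    with Haar probability mu.  An open normal subgroup N has at most countably
    many cosets, since they are disjoint nonempty open sets, and all of them
    have the same measure; the total mass being 1, there are finitely many, say
    n, each of measure 1/n.  The members of F(T) are closed under intersection,
    so their cosets (with the empty set) form a pi-system generating the Borel
    sets, and a finite Borel measure is determined by its values on them.

    - T is nonsingular iff every induced map T_N is surjective: a coset missed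
      by T_N has positive measure and empty preimage; conversely a surjective
      T_N is a permutation, so the preimage of a coset is a coset, whence T
      preserves mu ([nonsingular_criterion]).
    - T is ergodic iff every T_N is transitive: if T is ergodic, the points
      whose orbit meets a given coset form an invariant open set, which must
      have full measure and so meet every coset; conversely, if B is invariant
      and every T_N is transitive then B has the same measure in all cosets of
      N, so B is independent of all cosets, hence of itself
      ([ergodic_criterion]).

    For a product map, the boxes cut out by finitely many subgroups N_a in
    F(T_a) belong to F(T), and every neighbourhood of the identity contains one
    ([nbhs_box_factor]); so T is again quotient-preserving and only boxes have
    to be tested.  On a box the induced map is the product of finitely many
    T_{N_a}.  Such a product is surjective iff its factors are.  A transitive
    map of a set with n points is an n-cycle, and a product of cycles is
    transitive iff their lengths are pairwise coprime: one direction is the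
    Chinese remainder theorem ([prod_transitive_mod]), and in the other, a time
    k at which one coordinate is back at its start while another has moved one
    step ahead satisfies n | k and m | k - 1 ([factor_orders_coprime]). *)

Import Order.TTheory GRing.Theory Num.Theory.

(** * Cosets of a subgroup *)

Section Cosets.
Variables (G : topologicalGroupType) (N : set G).

Lemma left_cosetE x y : left_coset N x y <-> N (x^-1 * y).
Proof.
split=> [[n Nn <-]|Nxy]; first by rewrite mulKg.
by exists (x^-1 * y); rewrite ?mulVKg.
Qed.

Hypothesis sgN : group_closed [in N].

Lemma subgroup1 : N 1.
Proof. by have [/set_mem] := sgN. Qed.

Lemma subgroupVM x y : N x -> N y -> N (x^-1 * y).
Proof.
have [_ Nd] := sgN => Nx Ny.
have NV z : N z -> N z^-1.
  move=> Nz; rewrite -[z^-1]mul1g.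
  apply/set_mem; apply: Nd; apply/mem_set => //.
  exact: subgroup1.
by rewrite -[y]invgK; apply/set_mem; apply: Nd; apply/mem_set; apply: NV.
Qed.

Lemma left_coset_refl x : left_coset N x x.
Proof. by apply/left_cosetE; rewrite mulVg; apply: subgroup1. Qed.

Lemma left_coset_eqP x y : left_coset N x y <-> left_coset N x = left_coset N y.
Proof.
split=> [/left_cosetE Nxy|->]; last exact: left_coset_refl.
apply/seteqP; split=> z /left_cosetE Nz; apply/left_cosetE.
  by have := subgroupVM Nxy Nz; rewrite invgM invgK -mulgA mulVKg.
have := subgroupVM (subgroupVM Nxy subgroup1) Nz.
by rewrite mulg1 invgK -mulgA mulVKg.
Qed.

Lemma left_coset_sym x y : left_coset N x y -> left_coset N y x.
Proof. by move=> /left_coset_eqP h; apply/left_coset_eqP. Qed.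

Lemma left_coset_trans x y z :
  left_coset N x y -> left_coset N y z -> left_coset N x z.
Proof. by move=> /left_coset_eqP ->. Qed.

Lemma quotient_map_eqP x y :
  quotient_map N x = quotient_map N y <-> left_coset N x y.
Proof.
split=> [/(congr1 val)/= h|h]; first by apply/left_coset_eqP.
by apply: val_inj => /=; apply/left_coset_eqP.
Qed.

(** Frees the later arguments from the quotient type. *)
Lemma factors_throughP (T : G -> G) : factors_through T N <->
  forall x y, left_coset N x y -> left_coset N (T x) (T y).
Proof.
split=> [[TN TNE] x y /quotient_map_eqP xy|h].
  have /= Tx := congr1 (@^~ x) TNE; have /= Ty := congr1 (@^~ y) TNE.
  by apply/quotient_map_eqP; rewrite Tx Ty xy.
have rep (q : quotient N) : {x | quotient_map N x = q}.
  apply: cid; case: q => C /[dup] /set_mem [x _ xC] CN; exists x.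
  exact: val_inj.
exists (fun q => quotient_map N (T (sval (rep q)))).
apply/funext => x /=; apply/quotient_map_eqP; apply: h.
by apply/quotient_map_eqP; rewrite (svalP (rep _)).
Qed.

Lemma open_left_coset x : open N -> open (left_coset N x).
Proof.
move=> oN.
have -> : left_coset N x = (fun y => x^-1 * y) @^-1` N.
  by apply/seteqP; split=> y /left_cosetE.
apply: open_comp => // y _.
apply: (@continuous2_cvg _ _ _ _ _ _ (cst x^-1) id (fun a b : G => a * b)).
- exact: (@mulg_continuous G (x^-1, y)).
- exact: cvg_cst.
- exact: cvg_id.
Qed.

(** Numbering the cosets replaces the quotient by the finite type ['I_n]. *)
Lemma coset_index n : [set: quotient N] #= `I_n ->
  exists c : G -> 'I_n, (forall i, exists x, c x = i) /\
    forall x y, c x = c y <-> left_coset N x y.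
Proof.
move=> /card_set_bijP[f [fN f_inj f_surj]].
have lt_f q : (f q < n)%N by exact: fN.
pose c x := Ordinal (lt_f (quotient_map N x)).
exists c; split=> [i|x y].
  have [q _ fq] := f_surj i (ltn_ord i).
  have [x _ xq] := set_mem (valP q); exists x; apply: val_inj => /=.
  by rewrite -fq; congr f; apply: val_inj.
rewrite -quotient_map_eqP; split=> [/(congr1 val)/= h|xy].
  by apply: f_inj h; rewrite in_setT.
by apply: val_inj; rewrite /= xy.
Qed.

End Cosets.

(** * Haar measure of the cosets of an open subgroup *)

Section Haar.
Variables (G : topologicalGroupType) (R : realType).
Variable mu : probability (borel G) R.
Hypotheses (G_sc : @second_countable G) (mu_haar : normalized_haar mu).

Lemma open_borel (U : set G) : open U -> measurable (U : set (borel G)).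
Proof. exact: sub_sigma_algebra. Qed.

Section OneSubgroup.
Variable N : set G.
Hypothesis N_ons : open_normal_subgroup N.

Let oN : open N. Proof. by case: N_ons. Qed.
Let sgN : group_closed [in N]. Proof. by case: N_ons. Qed.

Lemma measurable_left_coset x :
  measurable (left_coset N x : set (borel G)).
Proof. by apply: open_borel; apply: open_left_coset. Qed.

Lemma measure_left_coset x : mu (left_coset N x) = mu N.
Proof. by apply: mu_haar; apply: open_borel. Qed.

(** Each coset contains a nonempty member of a countable base, and is recovered
    as the coset of any point of that member. *)
Lemma countable_cosets : countable (cosets N).
Proof.
have [B cB [oB bB]] := G_sc.
suff : cosets N `<=` (fun b => left_coset N (xget (1 : G) b)) @` B.
  move=> /subset_card_le/sub_countable; apply.
  exact: sub_countable (card_image_le _ _) cB.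
move=> _ [x _ <-].
have [b [Bb bx] bN] : filter_from [set U | B U /\ U x] id (left_coset N x).
  apply: bB; apply: open_nbhs_nbhs; split; first exact: open_left_coset.
  exact: left_coset_refl.
exists b => //; apply/esym; apply/(left_coset_eqP sgN)/bN.
by apply: xgetPex; exists x.
Qed.

Lemma cosets_meet C C' :
  cosets N C -> cosets N C' -> C `&` C' !=set0 -> C = C'.
Proof.
move=> [x _ <-] [y _ <-] [z [xz yz]].
by rewrite ((left_coset_eqP sgN _ _).1 xz) ((left_coset_eqP sgN _ _).1 yz).
Qed.

(** Infinitely many cosets would be countably many sets of equal measure whose
    measures add up to 1. *)
Lemma finite_cosets : finite_set (cosets N).
Proof.
apply: contrapT => /(eq_card_nat countable_cosets).
rewrite card_eq_sym => /card_set_bijP[F [FN F_inj F_surj]].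
have F_tr : trivIset [set: nat] F.
  move=> i j _ _ Fij.
  by apply: F_inj; rewrite ?in_setT //; apply: cosets_meet Fij; apply: FN.
have F_mu k : mu (F k) = mu N.
  by have [x _ <-] := FN k I; rewrite measure_left_coset.
have F_meas k : measurable (F k : set (borel G)).
  by have [x _ <-] := FN k I; apply: measurable_left_coset.
have F_cover : \bigcup_k F k = [set: borel G].
  apply/seteqP; split=> // x _.
  have [k _ Fk] := F_surj (left_coset N x) (imageT _ x).
  by exists k => //; rewrite Fk; apply: left_coset_refl.
have : (1 = \sum_(0 <= k <oo) mu (F k))%E.
  transitivity (mu (\bigcup_k F k)).
    by rewrite F_cover; apply/esym/probability_setT.
  apply: measure_semi_bigcup => //.
  by rewrite F_cover; apply: measurableT.
rewrite (eq_eseriesr (fun k _ => F_mu k)).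
have /fineK <- : mu N \is a fin_num.
  by apply: fin_num_measure; apply: open_borel.
have : (0 <= fine (mu N))%R by apply: fine_ge0.
move: (fine _) => r; rewrite le_eqVlt => /predU1P[<-|r_gt0 sum1].
  by rewrite eseries0// => /eqP; rewrite onee_eq0.
have r1_ge0 : (0 <= r^-1)%R by rewrite invr_ge0 ltW.
pose n := Num.Def.archi_bound (r^-1).
have : (\sum_(0 <= k < n) r%:E <= 1)%E.
  rewrite [leRHS]sum1; apply: nneseries_lim_ge => k _ _.
  by rewrite lee_fin ltW.
rewrite sumEFin lee_fin sumr_const_nat subn0 -mulr_natr.
apply/negP; rewrite -ltNge -[ltLHS](mulfV (lt0r_neq0 r_gt0)) ltr_pM2l//.
exact: archi_boundP.
Qed.

Lemma finite_quotient : finite_set [set: quotient N].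
Proof.
have [n Nn] := finite_cosets; exists n.
by apply: card_eq_trans Nn; apply: card_setT.
Qed.

(** Stated for the trace on a Borel set [B], so as to apply both to the whole
    group and to an invariant set. *)
Lemma measure_equidistributed n (B : set (borel G)) (r : \bar R) :
  [set: quotient N] #= `I_n -> measurable B ->
  (forall x, mu (B `&` left_coset N x) = r) -> mu B = (r *+ n)%E.
Proof.
move=> /(coset_index sgN)[c [c_surj cP]] mB Br.
pose F k : set (borel G) := B `&` [set x | c x = k :> nat].
have FE k : (k < n)%N -> exists x, F k = B `&` left_coset N x.
  move=> kn; have [x cx] := c_surj (Ordinal kn); exists x.
  congr (_ `&` _); apply/seteqP; split=> y /=.
    by move=> cy; apply/cP/val_inj; rewrite cx; exact/esym.
  by move=> /cP <-; rewrite cx.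
have -> : B = \bigcup_(k in `I_n) F k.
  apply/seteqP; split=> [x Bx|x [k _ []]//].
  by exists (c x); [exact: ltn_ord|split].
rewrite measure_fin_bigcup//; first last.
- by move=> k /FE[x ->]; apply: measurableI => //; apply: measurable_left_coset.
- by move=> i j _ _ [x [[_ <-] [_ <-]]].
rewrite -fsbig_ord (eq_bigr (fun=> r)) => [|k _].
  by rewrite big_const_ord; elim: (n) => // m IHm; rewrite muleS -IHm.
by have [x ->] := FE k (ltn_ord k); apply: Br.
Qed.

Lemma measure_subgroup n : [set: quotient N] #= `I_n -> (mu N *+ n = 1)%E.
Proof.
move=> /measure_equidistributed - /(_ setT (mu N)) <-//.
  exact: probability_setT.
by move=> x; rewrite setTI measure_left_coset.
Qed.

Lemma measure_subgroup_neq0 : mu N != 0%E.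
Proof.
have [n /measure_subgroup] := finite_quotient.
by apply: contra_eqN => /eqP ->; rewrite -mule_natl mule0 eq_sym onee_neq0.
Qed.

End OneSubgroup.
End Haar.

(** * The maps induced on finite quotients *)

Lemma surj_injective (X : finType) (f : X -> X) :
  (forall y, exists x, f x = y) -> injective f.
Proof.
move=> /choice[g fgK]; apply: (can_inj (g := g)).
exact/(bij_can_sym (injF_bij (can_inj fgK))).
Qed.

Definition surjective_mod (G : topologicalGroupType) (T : G -> G) (N : set G) :=
  forall y, exists x, left_coset N y (T x).

Definition transitive_mod (G : topologicalGroupType) (T : G -> G) (N : set G) :=
  forall x y, exists k, left_coset N y (iter k T x).

Section FiniteFactor.
Variables (G : topologicalGroupType) (T : G -> G).

Lemma transitive_surjective_mod N : transitive_mod T N -> surjective_mod T N.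
Proof.
(* An orbit started at [T y] has already made one step when it meets the coset
   of [y]. *)
move=> tN y; have [k yk] := tN (T y) y.
by exists (iter k T y); rewrite -iterS iterSr.
Qed.

Lemma sub_surjective_mod M N :
  M `<=` N -> surjective_mod T M -> surjective_mod T N.
Proof.
move=> MN sM y; have [x /left_cosetE yx] := sM y; exists x.
by apply/left_cosetE/MN.
Qed.

Lemma sub_transitive_mod M N :
  M `<=` N -> transitive_mod T M -> transitive_mod T N.
Proof.
move=> MN tM x y; have [k /left_cosetE yx] := tM x y; exists k.
by apply/left_cosetE/MN.
Qed.

Lemma finite_factor_set_coset N x y : finite_factor_set T N ->
  left_coset N x y -> left_coset N (T x) (T y).
Proof. by move=> [[_ sgN _] /(factors_throughP sgN)]; apply. Qed.

Lemma finite_factor_setI M N : finite_factor_set T M ->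
  finite_factor_set T N -> finite_factor_set T (M `&` N).
Proof.
move=> FM FN.
have [[oM sgM nM] _] := FM; have [[oN sgN nN] _] := FN.
have sgMN : group_closed [in M `&` N].
  split=> [|x y]; first by apply/mem_set; split; apply: subgroup1.
  move=> /set_mem[Mx Nx] /set_mem[My Ny]; apply/mem_set.
  by split; apply/set_mem; [apply: sgM.2|apply: sgN.2]; apply/mem_set.
split; first split=> //; first exact: openI.
  by move=> x y [Mx Nx]; split; [apply: nM|apply: nN].
apply/(factors_throughP sgMN) => x y /left_cosetE[xM xN].
apply/left_cosetE; split; apply/left_cosetE.
  by apply: finite_factor_set_coset FM _; apply/left_cosetE.
by apply: finite_factor_set_coset FN _; apply/left_cosetE.
Qed.

Lemma finite_factor_setT : finite_factor_set T setT.
Proof.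
have sg : group_closed [in [set: G]] by split=> [|x y _ _]; apply/mem_set.
split; first by split=> //; apply: openT.
by apply/(factors_throughP sg) => x y _; apply/left_cosetE.
Qed.

(** On a finite quotient a surjective map is a permutation; this one is
    transported to ['I_n] to make the theory of orbits available. *)
Lemma permutation_model N n : finite_factor_set T N ->
  [set: quotient N] #= `I_n -> surjective_mod T N ->
  exists (c : G -> 'I_n) (f : 'I_n -> 'I_n),
    [/\ forall i, exists x, c x = i,
        forall x y, c x = c y <-> left_coset N x y,
        forall k x, c (iter k T x) = iter k f (c x) &
        injective f].
Proof.
move=> FN; have [[_ sgN _] _] := FN => /(coset_index sgN)[c [c_surj cP]] sN.
have [g gK] := choice c_surj.
pose f i := c (T (g i)).
have cT x : c (T x) = f (c x).
  by apply/cP/(finite_factor_set_coset FN)/cP; rewrite gK.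
exists c, f; split=> // [k x|]; first by elim: k => //= k <-.
apply: surj_injective => i; have [x <-] := c_surj i.
by have [y xy] := sN x; exists (c y); rewrite -cT; apply/esym/cP.
Qed.

Lemma injective_mod N : finite_factor_set T N ->
  finite_set [set: quotient N] -> surjective_mod T N ->
  forall x y, left_coset N (T x) (T y) -> left_coset N x y.
Proof.
move=> FN [n Nn] sN x y.
have [c [f [_ cP cT f_inj]]] := permutation_model FN Nn sN.
by move=> /cP; rewrite (cT 1%N x) (cT 1%N y) => /f_inj/cP.
Qed.

Lemma recurrent_mod N : finite_factor_set T N ->
  finite_set [set: quotient N] -> surjective_mod T N ->
  forall x, exists k, left_coset N x (iter k.+1 T x).
Proof.
move=> FN [n Nn] sN x.
have [c [f [_ cP cT f_inj]]] := permutation_model FN Nn sN.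
exists (fingraph.order f (c x)).-1; apply/cP.
by rewrite cT prednK ?fingraph.order_gt0 ?iter_order.
Qed.

(** A transitive self-map of a set with [n] points is a cycle of length [n]. *)
Lemma iter_mod N n : finite_factor_set T N -> [set: quotient N] #= `I_n ->
  transitive_mod T N -> forall x k, left_coset N x (iter k T x) <-> (n %| k)%N.
Proof.
move=> FN Nn tN x k.
have [c [f [c_surj cP cT f_inj]]] :=
  permutation_model FN Nn (transitive_surjective_mod tN).
have f_order : fingraph.order f (c x) = n.
  rewrite -[RHS]card_ord; apply: eq_card => j; rewrite !inE.
  have [z <-] := c_surj j; have [m /cP zm] := tN x z.
  by rewrite zm cT; apply: fconnect_iter.
have iter_n m : iter (m * n) f (c x) = c x.
  elim: m => // m IHm; rewrite mulSn iterD IHm.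
  by have := iter_order f_inj (c x); rewrite f_order.
rewrite -cP cT; split=> [|/dvdnP[m ->]]; last by rewrite iter_n.
rewrite (divn_eq k n) addnC iterD iter_n => k_fix.
have n_gt0 : (0 < n)%N by rewrite -f_order fingraph.order_gt0.
have /findex_iter : (k %% n < fingraph.order f (c x))%N.
  by rewrite f_order ltn_mod.
by rewrite -k_fix findex0 => <-; rewrite dvdn_mull.
Qed.

End FiniteFactor.

(** * Borel sets and cosets of finite factors *)

Lemma quotient_preservingP (G : topologicalGroupType) (T : G -> G) :
  quotient_preserving T <-> forall x U, nbhs x U ->
    exists2 N, finite_factor_set T N & left_coset N x `<=` U.
Proof.
split=> [[_ bT] x U /bT[C [[N FN [y _ <-]] yx] CU]|bT].
  have [[_ sgN _] _] := FN; exists N => //.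
  by rewrite -((left_coset_eqP sgN _ _).1 yx).
split=> [C [N [[oN _ _] _] [x _ <-]]|x U /bT[N FN NU]].
  exact: open_left_coset.
have [[_ sgN _] _] := FN.
exists (left_coset N x) => //; split; last exact: left_coset_refl.
by exists N => //; exists x.
Qed.

Section Borel.
Variables (G : topologicalGroupType) (T : G -> G).
Hypothesis G_sc : @second_countable G.

(** By second countability every open set is a countable union of members of
    any given base. *)
Lemma borel_basis (B : set (set (borel G))) : basis (B : set (set G)) ->
  @measurable _ (borel G) = <<s B >>.
Proof.
move=> [oB bB]; apply/seteqP; split; last first.
  apply: smallest_sub; first exact: sigma_algebra_measurable.
  by move=> b /oB; apply: open_borel.
apply: smallest_sub; first exact: smallest_sigma_algebra.
move=> U oU; have [D cD [oD bD]] := G_sc.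
pose between (d b : set G) := [/\ B b, d `<=` b & b `<=` U].
pose D' := [set d | D d /\ exists b, between d b].
have /choice[b bP] : forall d : D', exists b, between (val d) b.
  by move=> [d /= /set_mem[]].
suff -> : U = \bigcup_d b d.
  apply: (@countable_bigcupT_measurable _ (g_sigma_algebraType B)) => [|d].
    rewrite (eq_countable (card_setT D')).
    by apply: sub_countable cD; apply: subset_card_le => d [].
  by apply: sub_sigma_algebra; case: (bP d).
apply/seteqP; split=> [x Ux|x [d _]]; last by case: (bP d) => _ _; apply.
have [a [Ba ax] aU] : filter_from [set V | B V /\ V x] id U.
  by apply: bB; apply: open_nbhs_nbhs.
have [d [Dd dx] da] : filter_from [set V | D V /\ V x] id a.
  by apply: bD; apply: open_nbhs_nbhs; split=> //; apply: oB.
have D'd : d \in D' by apply/mem_set; split=> //; exists a.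
by exists (SigSub D'd) => //; have [_ + _] := bP (SigSub D'd); apply.
Qed.

Hypothesis T_qp : quotient_preserving T.

(** Two cosets meet in the empty set or in a coset of the intersection, so
    adjoining the empty set makes the base a pi-system. *)
Let factor_cosets : set (set (borel G)) :=
  set0 |` \bigcup_(N in finite_factor_set T) cosets N.

Let factor_cosets_setI : setI_closed factor_cosets.
Proof.
move=> C D [->|[M FM [x _ <-]]]; first by left; rewrite set0I.
move=> [->|[N FN [y _ <-]]]; first by left; rewrite setI0.
have [[[_ sgM _] _] [[_ sgN _] _]] := (FM, FN).
have [[z [xz yz]]|/nonemptyPn ->] :=
  pselect (left_coset M x `&` left_coset N y !=set0); last by left.
right; exists (M `&` N); first exact: finite_factor_setI.
exists z => //; rewrite ((left_coset_eqP sgM _ _).1 xz).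
rewrite ((left_coset_eqP sgN _ _).1 yz).
apply/seteqP; split=> w => [/left_cosetE[]|[/left_cosetE ? /left_cosetE ?]].
  by split; apply/left_cosetE.
exact/left_cosetE.
Qed.

Let borel_factor_cosets : @measurable _ (borel G) = <<s factor_cosets >>.
Proof.
apply: borel_basis; have [oB bB] := T_qp; split.
  by move=> C [->|/oB//]; apply: open0.
move=> x U /bB[C [FC Cx] CU]; exists C => //; split=> //; by right.
Qed.

(** The cosets of the finite factors form a pi-system generating the Borel sets. *)
Lemma measure_unique_cosets (R : realType)
    (m1 m2 : measure (borel G) R) :
  (m1 setT < +oo)%E ->
  (forall N x, finite_factor_set T N ->
     m1 (left_coset N x) = m2 (left_coset N x)) ->
  forall B, measurable B -> m1 B = m2 B.
Proof.
move=> m1_fin m12 B; rewrite borel_factor_cosets.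
apply: (g_sigma_algebra_measure_unique factor_cosets _ (fun=> setT)) => //.
- by move=> C FC; rewrite borel_factor_cosets; apply: sub_sigma_algebra.
- move=> _; right; exists setT; first exact: finite_factor_setT.
  by exists 1 => //; apply/seteqP; split=> // x _; apply/left_cosetE.
- by apply: bigcup_const; exists 0%N.
- by move=> _ [->|[N FN [x _ <-]]]; [rewrite !measure0|apply: m12].
Qed.

End Borel.

(** * Criteria for nonsingularity and ergodicity *)

Section Criteria.
Variables (G : topologicalGroupType) (R : realType).
Variable mu : probability (borel G) R.
Variable T : G -> G.
Hypotheses (G_sc : @second_countable G) (mu_haar : normalized_haar mu).
Hypothesis T_qp : quotient_preserving T.

Let factor_open_normal N : finite_factor_set T N -> open_normal_subgroup N.
Proof. by case. Qed.

Let factor_finite N : finite_factor_set T N -> finite_set [set: quotient N].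
Proof. by move=> /factor_open_normal /(finite_quotient G_sc mu_haar). Qed.

Lemma preimage_left_coset N x : finite_factor_set T N -> surjective_mod T N ->
  T @^-1` left_coset N (T x) = left_coset N x.
Proof.
move=> FN sN; apply/seteqP; split=> y /=; last exact: finite_factor_set_coset.
exact: (injective_mod FN (factor_finite FN) sN).
Qed.

Lemma quotient_preserving_continuous : continuous T.
Proof.
apply/continuousP => U oU; rewrite openE => x /= Ux.
have [N FN NU] : exists2 N, finite_factor_set T N & left_coset N (T x) `<=` U.
  by move: T_qp => /quotient_preservingP; apply; apply: open_nbhs_nbhs.
have [[oN sgN _] _] := FN.
suff : nbhs x (left_coset N x).
  apply: filterS => z xz; apply: NU; exact: finite_factor_set_coset xz.
apply: open_nbhs_nbhs; split; first exact: open_left_coset.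
exact: left_coset_refl.
Qed.

Lemma quotient_preserving_measurable :
  measurable_fun setT (T : borel G -> borel G).
Proof.
apply: (measurability (@open G : set (set (borel G)))) => //.
move=> _ [U oU <-]; rewrite setTI; apply: open_borel.
by move/continuousP : quotient_preserving_continuous; apply.
Qed.

(** The image measure agrees with [mu] on cosets, because the preimage of a
    coset is a single coset of the same subgroup. *)
Lemma measure_preserving (B : set (borel G)) :
  (forall N, finite_factor_set T N -> surjective_mod T N) ->
  measurable B -> mu (T @^-1` B) = mu B.
Proof.
move=> sT mB.
pose T' : {mfun borel G >-> borel G} :=
  mfun_Sub (mem_set quotient_preserving_measurable).
apply: (@measure_unique_cosets _ T G_sc T_qp R (distribution mu T') mu) => //.
  exact: le_lt_trans (probability_le1 mu measurableT) (ltry 1).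
move=> N y FN; have [[_ sgN _] _] := FN.
have [x /(left_coset_eqP sgN) ->] := sT N FN y.
rewrite /= /distribution /pushforward mfun_valP.
rewrite (preimage_left_coset x FN (sT N FN)).
by rewrite !(measure_left_coset mu_haar (factor_open_normal FN)).
Qed.

Theorem nonsingular_criterion : nonsingular mu T <->
  forall N, finite_factor_set T N -> surjective_mod T N.
Proof.
split=> [[_ T_ns] N FN y|sT]; last first.
  split; first exact: quotient_preserving_measurable.
  by move=> B mB; rewrite measure_preserving.
have N_ons := factor_open_normal FN.
apply: contrapT => no_preim.
have : mu (left_coset N y) = 0%E.
  apply/T_ns; first exact: measurable_left_coset.
  rewrite (_ : T @^-1` _ = set0) ?measure0// -subset0 => x yTx.
  by apply: no_preim; exists x.
rewrite (measure_left_coset mu_haar N_ons).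
by apply/eqP/(measure_subgroup_neq0 G_sc mu_haar).
Qed.

(** Moving along an orbit of cosets does not change the measure of their
    intersection with an invariant set [B], so transitivity spreads [B] evenly
    over the cosets. *)
Lemma transitive_invariant_independent (B : set (borel G)) :
  (forall N, finite_factor_set T N -> transitive_mod T N) ->
  measurable B -> T @^-1` B = B ->
  forall C, measurable C -> mu (C `&` B) = (mu B * mu C)%E.
Proof.
move=> tT mB TB.
have sT N : finite_factor_set T N -> surjective_mod T N.
  by move=> /tT/transitive_surjective_mod.
have muB_fin : mu B \is a fin_num by apply: fin_num_measure.
have muB_ge0 : (0 <= fine (mu B))%R by apply: fine_ge0.
move=> C mC; rewrite -[mu B]fineK//.
apply: (@measure_unique_cosets _ T G_sc T_qp R (mrestr mu mB)
  (mscale (NngNum muB_ge0) mu)) => //.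
  by rewrite /= /mrestr setTI ltey_eq muB_fin.
move=> N x FN; rewrite /= /mrestr /mscale /=.
have N_ons := factor_open_normal FN; have [_ sgN _] := N_ons.
have step y : mu (B `&` left_coset N y) = mu (B `&` left_coset N (T y)).
  rewrite -[RHS]measure_preserving//; last first.
    by apply: measurableI => //; apply: measurable_left_coset.
  by rewrite preimage_setI TB (preimage_left_coset y FN (sT _ FN)).
have B_x y : mu (B `&` left_coset N y) = mu (B `&` left_coset N x).
  have [k /(left_coset_eqP sgN) ->] := tT _ FN y x.
  by elim: k => //= k ->; rewrite step.
have [n Nn] := finite_quotient G_sc mu_haar N_ons.
have muN := measure_subgroup mu_haar N_ons Nn.
rewrite fineK// (measure_equidistributed N_ons Nn mB B_x).
rewrite measure_left_coset// setIC.
by rewrite -mule_natl -muleA muleCA mule_natl muN mule1.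
Qed.

Theorem ergodic_criterion : ergodic mu T <->
  forall N, finite_factor_set T N -> transitive_mod T N.
Proof.
split=> [[T_ns T_erg] N FN x y|tT]; last first.
  split=> [|B mB TB].
    by apply/nonsingular_criterion => N /tT/transitive_surjective_mod.
  (* [B] is independent of itself. *)
  have := transitive_invariant_independent tT mB TB mB; rewrite setIid.
  have : mu B \is a fin_num by apply: fin_num_measure.
  case: (mu B) => // r _ /eqP; rewrite -EFinM eqe.
  rewrite -subr_eq0 -{1}[r]mulr1 -mulrBr mulf_eq0 subr_eq0.
  by move=> /orP[/eqP->|/eqP<-]; [left|right].
have sN := nonsingular_criterion.1 T_ns N FN.
have N_ons := factor_open_normal FN; have [oN sgN _] := N_ons.
(* Invariance of the set of points whose orbit meets the coset of [y] needs
   recurrence, since the visit may take place at time 0. *)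
pose B : set (borel G) := [set z | exists k, left_coset N y (iter k T z)].
have TB : T @^-1` B = B.
  apply/seteqP; split=> z /= [k yk]; first by exists k.+1; rewrite iterSr.
  have [m zm] := recurrent_mod FN (factor_finite FN) sN z.
  exists (k + m)%N; apply: (left_coset_trans sgN) yk _.
  rewrite -iterSr -addnS iterD.
  elim: k => //= k IHk; exact: finite_factor_set_coset.
have mB : measurable B.
  have -> : B = \bigcup_k (iter k T @^-1` left_coset N y).
    by apply/seteqP; split=> z [k] => [|_] yk; exists k.
  apply: bigcup_measurable => k _; apply: open_borel.
  apply/(open_comp _ (open_left_coset y oN)) => z _.
  elim: k z => [|k IHk] z; first exact: cvg_id.
  exact: (continuous_comp (IHk z) (@quotient_preserving_continuous _)).
have mC z : measurable (left_coset N z : set (borel G)).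
  exact: measurable_left_coset.
have muC z : mu (left_coset N z) != 0%E.
  rewrite (measure_left_coset mu_haar N_ons).
  exact: (measure_subgroup_neq0 G_sc mu_haar N_ons).
apply: contrapT => nBx.
case: (T_erg B mB TB) => muB.
  have /eqP : mu (left_coset N y) = 0%E.
    apply: subset_measure0 muB => // z yz; by exists 0%N.
  exact/negP.
have /eqP : mu (left_coset N x) = 0%E.
  apply: (@subset_measure0 _ _ _ mu _ (~` B)) => //; first exact: measurableC.
    move=> z xz [k yk]; apply: nBx; exists k.
    apply: (left_coset_trans sgN) yk _; apply: (left_coset_sym sgN).
    elim: k => //= k IHk; exact: finite_factor_set_coset.
  by apply: etrans (probability_setC mu mB) _; rewrite muB subee.
exact/negP.
Qed.

End Criteria.

(** * Boxes in a product of groups *)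

Section Product.
Variables (A : countType) (G : A -> topologicalGroupType).
Local Notation P := (prod_topology G).

Definition box (s : seq A) (V : forall a, set (G a)) : set P :=
  [set x | forall a, a \in s -> V a (x a)].

Lemma left_coset_cylinder a (N : set (G a)) (x y : P) :
  left_coset [set z : P | N (z a)] x y <-> left_coset N (x a) (y a).
Proof. by rewrite !left_cosetE. Qed.

Lemma open_cylinder a (V : set (G a)) : open V -> open [set x : P | V (x a)].
Proof.
by move=> oV; apply: (@open_comp _ _ (fun x : P => x a)) oV => x _;
  apply: prod_coord_continuous.
Qed.

Lemma box_cons a s V : box (a :: s) V = [set x | V a (x a)] `&` box s V.
Proof.
apply/seteqP; split=> [x xV|x [xa xs] b].
  by split=> [|b bs]; apply: xV; rewrite inE ?eqxx// bs orbT.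
by rewrite inE => /predU1P[->//|/xs].
Qed.

Lemma open_box s (V : forall a, set (G a)) :
  (forall a, open (V a)) -> open (box s V).
Proof.
move=> oV; elim: s => [|a s IHs].
  by rewrite (_ : box _ _ = setT); [apply: openT|apply/seteqP; split].
by rewrite box_cons; apply: openI => //; apply: open_cylinder.
Qed.

(** The sets containing a box of neighbourhoods of the coordinates of [x] form a
    filter that converges to [x] in each coordinate, hence in the product. *)
Lemma nbhs_box (x : P) U : nbhs x U ->
  exists s (V : forall a, set (G a)),
    (forall a, nbhs (x a) (V a)) /\ box s V `<=` U.
Proof.
pose F : set_system P := [set W : set P | exists s (V : forall a, set (G a)),
  (forall a, nbhs (x a) (V a)) /\ box s V `<=` W].
have F_filter : Filter F.
  split.
  - exists [::], (fun=> setT); split=> // a; exact: filterT.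
  - move=> W W' [s [V [nV sV]]] [s' [V' [nV' sV']]].
    exists (s ++ s'), (fun a => V a `&` V' a); split=> [a|y yVV'].
      exact: filterI.
    split; [apply: sV|apply: sV'] => a sa.
      by have [] := yVV' a; rewrite // mem_cat sa.
    by have [] := yVV' a; rewrite // mem_cat sa orbT.
  - move=> W W' WW' [s [V [nV sV]]]; exists s, V; split=> //.
    exact: subset_trans WW'.
suff : F --> x by apply.
apply/cvg_sup => a W.
rewrite (@nbhsE (initial_topology (fun f : P => f a))).
move=> [_ [[V oV <-] Vx] VW].
exists [:: a], (dfwith (fun b => setT) a V); split=> [b|y yV].
  case: dfwithP => [|b' _]; last exact: filterT.
  exact: open_nbhs_nbhs.
by apply: VW; have := yV a (mem_head _ _); rewrite dfwithin.
Qed.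

Lemma second_countable_enum (X : topologicalType) (x0 : X) :
  @second_countable X -> exists e : nat -> set X, basis (range e).
Proof.
move=> [B cB bB]; have [_ /(_ x0 setT filterT)[b [Bb _] _]] := bB.
move: cB => /pfcard_geP[B0|[e]]; first by rewrite B0 in Bb.
exists e; rewrite (_ : range e = B)//.
exact: image_eq.
Qed.

Lemma second_countable_prod : (forall a, @second_countable (G a)) ->
  @second_countable P.
Proof.
move=> G_sc.
have e_ex a : exists e : nat -> set (G a), basis (range e).
  exact: (second_countable_enum (1 : G a)).
pose e a := sval (cid (e_ex a)).
have eP a : basis (range (e a)) := svalP (cid (e_ex a)).
(* A basic box is coded by the finite list of its coordinates and the parallel
   list of the numbers of the basic open sets used there. *)
pose b (l : seq A * seq nat) : set P :=
  box l.1 (fun a => e a (nth 0%N l.2 (index a l.1))).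
exists (range b).
  exact: sub_countable (card_image_le _ _) (countableP _).
split=> [_ [l _ <-]|x U /nbhs_box[s [V [nV sV]]]].
  by apply: open_box => a; apply: (eP a).1; apply: imageT.
have n_ex a : exists n, e a n (x a) /\ e a n `<=` V a.
  by have [_ [[n _ <-] ?] ?] := (eP a).2 (x a) (V a) (nV a); exists n.
have [n nP] := choice n_ex.
exists (b (s, map n s)).
  split; first exact: imageT.
  by move=> a sa /=; rewrite (nth_map a) ?index_mem// nth_index//; case: (nP a).
move=> y yb; apply: sV => a sa; apply: (nP a).2.
by have := yb a sa; rewrite /= (nth_map a) ?index_mem// nth_index.
Qed.

Variable T : forall a, G a -> G a.
Local Notation TP := (prod_map T).

Lemma iter_prod_map k (x : P) a : iter k TP x a = iter k (@T a) (x a).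
Proof. by elim: k => //= k <-. Qed.

Lemma cylinder_factor a (N : set (G a)) : finite_factor_set (@T a) N ->
  finite_factor_set TP [set x | N (x a)].
Proof.
move=> FN; have [[oN [N1 NM] nN] _] := FN.
have sg : group_closed [in [set x : P | N (x a)]].
  split=> [|x y /set_mem xN /set_mem yN]; apply/mem_set; first exact/set_mem.
  by apply/set_mem/NM; apply/mem_set.
split; first split=> //; first exact: open_cylinder.
  by move=> x y; apply: nN.
apply/(factors_throughP sg) => x y /left_cosetE/= xy; apply/left_cosetE => /=.
exact/left_cosetE/(finite_factor_set_coset FN)/left_cosetE.
Qed.

Lemma box_factor s (N : forall a, set (G a)) :
  (forall a, finite_factor_set (@T a) (N a)) ->
  finite_factor_set TP (box s N).
Proof.
move=> FN; elim: s => [|a s IHs].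
  rewrite (_ : box _ _ = setT); first exact: finite_factor_setT.
  by apply/seteqP; split.
rewrite box_cons; apply: finite_factor_setI => //; exact: cylinder_factor.
Qed.

Lemma left_coset_box s (N : forall a, set (G a)) (x y : P) :
  left_coset (box s N) x y <->
  forall a, a \in s -> left_coset (N a) (x a) (y a).
Proof.
rewrite left_cosetE; split=> xy a /xy; first by move=> ?; apply/left_cosetE.
by move=> /left_cosetE.
Qed.

Hypothesis T_qp : forall a, quotient_preserving (@T a).

Lemma nbhs_box_factor (x : P) U : nbhs x U ->
  exists s (N : forall a, set (G a)),
    (forall a, finite_factor_set (@T a) (N a)) /\
    left_coset (box s N) x `<=` U.
Proof.
move=> /nbhs_box[s [V [nV sV]]].
have N_ex a :
    exists N, finite_factor_set (@T a) N /\ left_coset N (x a) `<=` V a.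
  have /quotient_preservingP/(_ (x a) (V a) (nV a))[N FN NV] := T_qp a.
  by exists N.
pose N a := sval (cid (N_ex a)).
have NP a := svalP (cid (N_ex a)).
exists s, N; split=> [a|y /left_coset_box xy]; first by case: (NP a).
by apply: sV => a sa; apply: (NP a).2; apply: xy.
Qed.

Lemma prod_map_quotient_preserving : quotient_preserving TP.
Proof.
apply/quotient_preservingP => x U /nbhs_box_factor[s [N [FN NU]]].
by exists (box s N) => //; apply: box_factor.
Qed.

Lemma factor_contains_box M : finite_factor_set TP M ->
  exists s (N : forall a, set (G a)),
    (forall a, finite_factor_set (@T a) (N a)) /\ box s N `<=` M.
Proof.
move=> [[oM sgM _] _].
have /nbhs_box_factor[s [N [FN NM]]] : nbhs (1 : P) M.
  by apply: open_nbhs_nbhs; split=> //; apply: subgroup1.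
exists s, N; split=> // x xN; apply: NM; apply/left_coset_box => a sa.
by apply/left_cosetE; rewrite invg1 mul1g; apply: xN.
Qed.

Lemma prod_surjective_mod :
  (forall N, finite_factor_set TP N -> surjective_mod TP N) <->
  forall a N, finite_factor_set (@T a) N -> surjective_mod (@T a) N.
Proof.
split=> [sT a N FN y|sT M /factor_contains_box[s [N [FN NM]]]].
  have [x /left_coset_cylinder] :=
    sT _ (cylinder_factor FN) (dfwith (fun b => 1) a y).
  by rewrite dfwithin; exists (x a).
apply: sub_surjective_mod NM _ => y.
have x_ex a : exists x, left_coset (N a) (y a) (T x) := sT a _ (FN a) (y a).
exists (fun a => sval (cid (x_ex a))); apply/left_coset_box => a _.
exact: (svalP (cid (x_ex a))).
Qed.

Lemma factor_transitive_mod a N : finite_factor_set (@T a) N ->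
  (forall N, finite_factor_set TP N -> transitive_mod TP N) ->
  transitive_mod (@T a) N.
Proof.
move=> FN tT x y.
have [k /left_coset_cylinder] := tT _ (cylinder_factor FN)
  (dfwith (fun b => 1) a x) (dfwith (fun b => 1) a y).
by rewrite iter_prod_map !dfwithin; exists k.
Qed.

(** Run the product from the identity until coordinate [a] is back at its start
    while coordinate [b] is one step ahead: if this takes [k] steps, then [n]
    divides [k] and [m] divides [k - 1]. *)
Lemma factor_orders_coprime a b n m : a <> b ->
  (forall N, finite_factor_set TP N -> transitive_mod TP N) ->
  factor_orders (@T a) n -> factor_orders (@T b) m -> coprime n m.
Proof.
move=> /eqP ab tT [N FN Nn] [M FM Mm].
have tN := factor_transitive_mod FN tT; have tM := factor_transitive_mod FM tT.
have [k] := tT _ (finite_factor_setI (cylinder_factor FN) (cylinder_factor FM))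
  (fun=> 1) (dfwith (fun b => 1) b (T (1 : G b))).
move=> /left_cosetE[/left_cosetE/left_coset_cylinder + /left_cosetE].
move=> + /left_coset_cylinder; rewrite !iter_prod_map dfwithin.
rewrite dfwithout 1?eq_sym// => /(iter_mod FN Nn tN).
case: k => [_|k nk].
  (* At time 0 one step already returns to the start, so [m] is 1. *)
  have [[_ sgM _] _] := FM.
  move=> /(left_coset_sym sgM)/(iter_mod FM Mm tM _ 1%N).
  by rewrite dvdn1 => /eqP ->; rewrite coprimen1.
rewrite iterSr => /(iter_mod FM Mm tM) mk.
exact: coprime_dvdl nk (coprime_dvdr mk (coprimeSn k)).
Qed.

End Product.

(** * Products of cycles of coprime lengths *)

Lemma chinese_seq (I : eqType) (s : seq I) (m r : I -> nat) :
  {in s &, forall a b, a != b -> coprime (m a) (m b)} ->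
  exists k, {in s, forall a, k = r a %[mod m a]}.
Proof.
elim: s => [|a s IHs] co_m; first by exists 0%N.
have [|k kP] := IHs.
  by move=> b c bs cs; apply: co_m; rewrite inE ?bs ?cs orbT.
have [a_s|a_s] := boolP (a \in s).
  by exists k => b; rewrite inE => /predU1P[->|]; apply: kP.
have co_a : coprime (m a) (\prod_(b <- s) m b).
  rewrite big_seq; elim/big_ind: _ => [|p q ap aq|b bs]; rewrite ?coprimen1//.
    by rewrite coprimeMr ap.
  apply: co_m; rewrite ?mem_head// ?inE ?bs ?orbT//.
  by apply: contraNneq a_s => ->.
exists (chinese (m a) (\prod_(b <- s) m b) (r a) k) => b.
rewrite inE => /predU1P[->|bs]; first by rewrite chinese_modl.
have m_dvd : (m b %| \prod_(c <- s) m c)%N by rewrite (big_rem b)//= dvdn_mulr.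
rewrite -(kP b bs) -(modn_dvdm _ m_dvd) chinese_modr//.
by rewrite modn_dvdm.
Qed.

(** Each coordinate prescribes the number of steps modulo the length of its
    cycle, and the Chinese remainder theorem meets all demands at once. *)
Lemma prod_transitive_mod (A : countType) (G : A -> topologicalGroupType)
    (T : forall a, G a -> G a) (s : seq A) (N : forall a, set (G a))
    (n : A -> nat) :
  (forall a, finite_factor_set (@T a) (N a)) ->
  (forall a, [set: quotient (N a)] #= `I_(n a)) ->
  (forall a, transitive_mod (@T a) (N a)) ->
  {in s &, forall a b, a != b -> coprime (n a) (n b)} ->
  transitive_mod (prod_map T) (box s N).
Proof.
move=> FN Nn tN co_n x y.
have /choice[r rP] : forall a, exists k,
    left_coset (N a) (y a) (iter k (@T a) (x a)).
  by move=> a; apply: tN.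
have [k kP] := chinese_seq r co_n.
exists k; apply/left_coset_box => a sa; rewrite iter_prod_map.
have [[_ sgN _] _] := FN a.
have red j : left_coset (N a)
    (iter (j %% n a) (@T a) (x a)) (iter j (@T a) (x a)).
  rewrite [in X in left_coset _ _ X](divn_eq j (n a)) iterD.
  by apply/(iter_mod (FN a) (Nn a) (tN a)); rewrite dvdn_mull.
apply: (left_coset_trans sgN) (rP a) _.
apply: (left_coset_trans sgN) (left_coset_sym sgN (red (r a))) _.
by rewrite -(kP a sa); apply: red.
Qed.

(** * The product theorem *)

Theorem theorem6p3 (A : countType) (G : A -> topologicalGroupType)
    (T : forall a : A, G a -> G a)
    (G_profinite : forall a : A, profinite (G a))
    (G_second_countable : forall a : A, @second_countable (G a))
    (T_quotient_preserving : forall a : A, quotient_preserving (T a)) :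
  @second_countable (prod_topology G) /\
  forall (R : realType) (mu : forall a : A, probability (borel (G a)) R)
      (muG : probability (borel (prod_topology G)) R),
    (forall a : A, normalized_haar (mu a)) ->
    normalized_haar muG ->
    (nonsingular muG (prod_map T) <->
      forall a : A, nonsingular (mu a) (T a)) /\
    (ergodic muG (prod_map T) <->
      (forall a : A, ergodic (mu a) (T a)) /\
      (forall a b : A, a <> b -> forall n m : nat,
         factor_orders (T a) n -> factor_orders (T b) m -> gcdn n m = 1%N)).
Proof.
have G_sc := second_countable_prod G_second_countable.
split=> // R mu muG mu_haar muG_haar.
have T_qp := prod_map_quotient_preserving T_quotient_preserving.
have nsP a := nonsingular_criterion (G_second_countable a) (mu_haar a)
  (T_quotient_preserving a).
have ergP a := ergodic_criterion (G_second_countable a) (mu_haar a)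
  (T_quotient_preserving a).
split.
  rewrite (nonsingular_criterion G_sc muG_haar T_qp).
  rewrite (prod_surjective_mod T_quotient_preserving).
  by split=> sT a; [apply/nsP/sT|apply/nsP].
rewrite (ergodic_criterion G_sc muG_haar T_qp).
split=> [tT|[T_erg co_T] M /(factor_contains_box T_quotient_preserving)].
  split=> [a|a b ab n m aP bP].
    by apply/ergP => N FN; apply: factor_transitive_mod.
  exact/eqP/(factor_orders_coprime ab tT).
move=> [s [N [FN NM]]]; apply: sub_transitive_mod NM _.
have /choice[n Nn] : forall a, exists k, [set: quotient (N a)] #= `I_k.
  move=> a; have [N_ons _] := FN a.
  by have := finite_quotient (G_second_countable a) (mu_haar a) N_ons.
apply: (prod_transitive_mod FN Nn) => [a|a b _ _ /eqP ab].
  exact: (ergP a).1 (T_erg a) _ (FN a).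
by apply/eqP/(co_T a b ab); [exists (N a)|exists (N b)].
Qed.
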